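(* Let $m_1(\varepsilon),\dots,m_N(\varepsilon),\mu_1(\varepsilon),\dots,\mu_k(\varepsilon)$ be positive masses depending on a parameter $\varepsilon>0$ (discrete or continuous, tending to $0$), and for each $\varepsilon$ let $(q_1(\varepsilon),\dots,q_N(\varepsilon),p_1(\varepsilon),\dots,p_k(\varepsilon))\in(\mathbb{R}^2)^{N+k}$ be a normalized central configuration of $N+k$ bodies with these masses ($m_i(\varepsilon)$ being the mass of $q_i(\varepsilon)$ and $\mu_j(\varepsilon)$ the mass of $p_j(\varepsilon)$). Assume that as $\varepsilon\to 0$ $$m_i(\varepsilon)\to \overline{m}_i>0,\qquad \mu_j(\varepsilon)\to 0,\qquad q_i(\varepsilon)\to\overline{q}_i,\qquad p_j(\varepsilon)\to\overline{p}_j$$ for $i=1,\dots,N$ and $j=1,\dots,k$. Then: (A) $\overline{Q}_N=(\overline{q}_1,\dots,\overline{q}_N)$ is a normalized central configuration for the masses $(\overline{m}_1,\dots,\overline{m}_N)$; (B) for every $j=1,\dots,k$, $\overline{p}_j$ is a relative normalized central configuration in the restricted $(N+1)$-body problem for the configuration $\overline{Q}_N$ with masses $(\overline{m}_1,\dots,\overline{m}_N)$.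
   Context: A normalized central configuration of $n$ bodies in the plane with positive masses $m_1,\dots,m_n$ is $(q_1,\dots,q_n)\in(\mathbb{R}^2)^n$ with pairwise distinct $q_i$ satisfying $$q_i=\sum_{j\ne i}\frac{m_j}{|q_i-q_j|^3}(q_i-q_j),\qquad i=1,\dots,n$$ (in particular $\sum_i m_iq_i=0$). Given $Q_N=(q_1,\dots,q_N)$ with masses $m=(m_1,\dots,m_N)$, the potential of the restricted $(N+1)$-body problem is $$V_{\rm res}(Q_N,p)=\frac{|p|^2}{2}+\sum_{i=1}^N\frac{m_i}{|p-q_i|},\qquad p\in\mathbb{R}^2\setminus\{q_1,\dots,q_N\}.$$ A point $x^*$ (different from all $q_i$) with $\frac{\partial V_{\rm res}}{\partial p}(Q_N,x^* )=0$ is called a relative normalized central configuration in the restricted $(N+1)$-body problem for $Q_N$. *)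

(* Defs.v *)
From HB Require Import structures.
From mathcomp Require Import all_boot all_order all_algebra.
From mathcomp Require Import all_classical all_reals all_analysis.

Set Implicit Arguments.
Unset Strict Implicit.
Unset Printing Implicit Defensive.

Import Order.TTheory GRing.Theory Num.Theory.
Import numFieldNormedType.Exports.

Local Open Scope classical_set_scope.
Local Open Scope ring_scope.

(* The library norm on ['rV[R]_2] is the sup norm, hence this definition; both
   norms induce the same topology and the same notion of derivative. *)
Definition enorm (R : realType) (v : 'rV[R]_2) : R :=
  Num.sqrt (\sum_(i < 2) v 0 i ^+ 2).

Definition normalized_cc (R : realType) (n : nat)
    (m : 'I_n -> R) (q : 'I_n -> 'rV[R]_2) : Prop :=
  [/\ forall i, 0 < m i,
      injective q &
      forall i, q i =
        \sum_(j < n | j != i) (m j / enorm (q i - q j) ^+ 3) *: (q i - q j)].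

(* Total on the plane: the inverse of 0 being 0, the value at [p = Q i] is
   irrelevant; it is never used below. *)
Definition Vres (R : realType) (N : nat)
    (m : 'I_N -> R) (Q : 'I_N -> 'rV[R]_2) (p : 'rV[R]_2) : R :=
  enorm p ^+ 2 / 2 + \sum_(i < N) m i / enorm (p - Q i).

(* [is_diff x f 0] asserts that [f] is differentiable at [x], with zero
   differential; [V_res] is smooth away from the [Q i]. *)
Definition relative_normalized_cc (R : realType) (N : nat)
    (m : 'I_N -> R) (Q : 'I_N -> 'rV[R]_2) (x : 'rV[R]_2) : Prop :=
  (forall i, x != Q i) /\ is_diff x (Vres m Q) 0.

Definition fconcat (T : Type) (N k : nat) (u : 'I_N -> T) (v : 'I_k -> T)
    (i : 'I_(N + k)) : T :=
  match fintype.split i with inl a => u a | inr b => v b end.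

(* Main.v *)
Require Import Defs.
From HB Require Import structures.
From mathcomp Require Import all_boot all_order all_algebra.
From mathcomp Require Import all_classical all_reals all_analysis.
From mathcomp Require Import ring.

Set Implicit Arguments.
Unset Strict Implicit.
Unset Printing Implicit Defensive.

Import Order.TTheory GRing.Theory Num.Theory.
Import numFieldNormedType.Exports.

Local Open Scope classical_set_scope.
Local Open Scope ring_scope.

(* Group the N + k bodies into clusters sharing the same limit. In the equation
   of a body, the terms due to the other clusters converge; the terms due to its
   own cluster may blow up, but being mutual attractions they cancel in the
   mass-weighted sum over the cluster. Hence the limit equation without internal
   terms holds at every cluster. If a cluster contained a body of positive
   limit mass together with other bodies, the moment of the equations about
   that body would bound the internal potential energy by sum_i M_i * o(1/r_i),
   r_i being the distance to it, whereas that energy is at least a positive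
   constant times sum_i M_i / r_i. So heavy bodies collide with nothing, and
   light ones contribute nothing to the limit equations. *)

(** * Limits of finite sums and of the Euclidean norm *)

Lemma cvg_sumr (R : realType) (V : normedModType R) (I T : Type)
    (F : set_system T) (FF : Filter F) (r : seq I) (P : pred I)
    (f : I -> T -> V) (l : I -> V) :
  (forall i, P i -> f i t @[t --> F] --> l i) ->
  \sum_(i <- r | P i) f i t @[t --> F] --> \sum_(i <- r | P i) l i.
Proof. by move=> fl; apply: cvg_big => //; exact: add_continuous. Qed.

Lemma enorm_ge0 (R : realType) (v : 'rV[R]_2) : 0 <= enorm v.
Proof. exact: sqrtr_ge0. Qed.

Lemma sqr_enorm (R : realType) (v : 'rV[R]_2) :
  enorm v ^+ 2 = \sum_(i < 2) v 0 i ^+ 2.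
Proof. by rewrite sqr_sqrtr// sumr_ge0// => i _; exact: sqr_ge0. Qed.

Lemma enorm_eq0 (R : realType) (v : 'rV[R]_2) : (enorm v == 0) = (v == 0).
Proof.
rewrite -sqrf_eq0 sqr_enorm psumr_eq0; last by move=> i _; exact: sqr_ge0.
apply/allP/eqP => [v0|-> i _]; last by rewrite /= mxE expr0n.
apply/rowP => i; rewrite mxE; apply/eqP; rewrite -sqrf_eq0.
exact: (v0 i (mem_index_enum i)).
Qed.

Lemma enorm_gt0 (R : realType) (v : 'rV[R]_2) : (0 < enorm v) = (v != 0).
Proof. by rewrite lt_def enorm_ge0 andbT enorm_eq0. Qed.

Lemma enormN (R : realType) (v : 'rV[R]_2) : enorm (- v) = enorm v.
Proof.
by congr Num.sqrt; apply: eq_bigr => i _; rewrite mxE sqrrN.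
Qed.

Lemma cvg_coord (R : realType) (T : Type) (F : set_system T) (FF : Filter F)
    (m n : nat) (f : T -> 'M[R]_(m, n)) (v : 'M[R]_(m, n)) i j :
  f t @[t --> F] --> v -> f t i j @[t --> F] --> v i j.
Proof.
apply: (@continuous_cvg _ _ _ _ _ f (fun A : 'M[R]_(m, n) => A i j)).
exact: coord_continuous.
Qed.

Lemma cvg_enorm (R : realType) (T : Type) (F : set_system T) (FF : Filter F)
    (f : T -> 'rV[R]_2) (v : 'rV[R]_2) :
  f t @[t --> F] --> v -> enorm (f t) @[t --> F] --> enorm v.
Proof.
move=> fv; apply: (@continuous_cvg _ _ _ _ _ _ Num.sqrt).
  exact: sqrt_continuous.
apply: cvg_sumr => i _.
apply: (@continuous_cvg _ _ _ _ _ _ (fun r : R => r ^+ 2)).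
  exact: exprn_continuous.
exact: cvg_coord.
Qed.

(** * Symmetric double sums *)

Section FiniteSums.
Context {R : realFieldType} {I : finType}.
Implicit Types (S : pred I) (K : I -> I -> R).

(** Exchanging [i] and [j] flips the sign of [y i - y j]; averaging the two forms gives the factor
    1/2. A constant [f] yields 0, and [f = y] up to a translation yields a sum of squares weighted
    by [K]. *)
Lemma sum_pairwise_diff S K (f y : I -> R) :
  (forall i j, K i j = K j i) ->
  \sum_(i | S i) f i * (\sum_(j | S j) K i j * (y i - y j)) =
  2^-1 * \sum_(i | S i) \sum_(j | S j) K i j * ((f i - f j) * (y i - y j)).
Proof.
move=> Ksym; set s := LHS.
have s2 : s = \sum_(i | S i) \sum_(j | S j) - (K i j * (f j * (y i - y j))).
  rewrite exchange_big /s /=; apply: eq_bigr => i _.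
  rewrite mulr_sumr; apply: eq_bigr => j _.
  by rewrite Ksym -!mulrN opprB mulrCA.
suff -> : \sum_(i | S i) \sum_(j | S j) K i j * ((f i - f j) * (y i - y j)) =
    s + s by rewrite -mulr2n -(mulr_natl s) mulKf// pnatr_eq0.
rewrite {2}s2 /s -big_split; apply: eq_bigr => i _ /=.
rewrite mulr_sumr -big_split; apply: eq_bigr => j _ /=.
by rewrite mulrBl mulrBr mulrCA.
Qed.

(** Each pair containing [a] is counted twice, in its row and in its column; the remaining terms are
    nonnegative. *)
Lemma sum_row_le S K (a : I) :
  (forall i j, K i j = K j i) -> (forall i j, 0 <= K i j) -> S a ->
  \sum_(i | S i && (i != a)) K a i <=
  2^-1 * \sum_(i | S i) \sum_(j | S j) K i j.
Proof.
move=> Ksym K0 Sa.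
rewrite mulrC ler_pdivlMr// mulr_natr mulr2n [leRHS](bigD1 a)//=.
apply: lerD.
  by rewrite [leRHS](bigD1 a)//= lerDr.
apply: ler_sum => i _.
by rewrite [leRHS](bigD1 a)//= Ksym lerDl sumr_ge0.
Qed.

End FiniteSums.

(** * Attractions and their moments *)

Definition attraction (R : realType) (n : nat) (M : 'I_n -> R)
    (x : 'I_n -> 'rV[R]_2) (i j : 'I_n) : 'rV[R]_2 :=
  (M j / enorm (x i - x j) ^+ 3) *: (x i - x j).

(** Only bodies outside [S] enter, so this stays regular when those of [S] collide with each other;
    for a central configuration it equals the attraction from within [S], whose terms may blow
    up. *)
Definition residual (R : realType) (n : nat) (S : pred 'I_n) (M : 'I_n -> R)
    (x : 'I_n -> 'rV[R]_2) (i : 'I_n) : 'rV[R]_2 :=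
  x i - \sum_(j | ~~ S j) attraction M x i j.

Lemma attractionii (R : realType) (n : nat) (M : 'I_n -> R)
  (x : 'I_n -> 'rV[R]_2) (i : 'I_n) : attraction M x i i = 0.
Proof. by rewrite /attraction subrr scaler0. Qed.

Lemma residual_cc (R : realType) (n : nat) (S : pred 'I_n) (M : 'I_n -> R)
    (x : 'I_n -> 'rV[R]_2) (i : 'I_n) : normalized_cc M x ->
  residual S M x i = \sum_(j | S j) attraction M x i j.
Proof.
case=> _ _ /(_ i) xE.
have {}xE : x i = \sum_j attraction M x i j.
  by rewrite (bigD1 i)//= attractionii add0r {1}xE.
by rewrite /residual {1}xE (bigID S)/= addrK.
Qed.

(** The weight [M i] makes the kernel symmetric, as [sum_pairwise_diff] requires. *)
Lemma residual_moment (R : realType) (n : nat) (S : pred 'I_n) (M : 'I_n -> R)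
    (x : 'I_n -> 'rV[R]_2) (f : 'I_n -> R) (c : 'I_2) : normalized_cc M x ->
  \sum_(i | S i) M i * (f i * residual S M x i 0 c) =
  2^-1 * \sum_(i | S i) \sum_(j | S j) M i * M j / enorm (x i - x j) ^+ 3 *
    ((f i - f j) * (x i 0 c - x j 0 c)).
Proof.
move=> Mx; rewrite -sum_pairwise_diff; last first.
  by move=> i j; rewrite [M i * _]mulrC -(opprB (x i)) enormN.
apply: eq_bigr => i _; rewrite mulrCA (residual_cc _ _ Mx) summxE !mulr_sumr.
by apply: eq_bigr => j _; rewrite !mxE !mulrA.
Qed.

(** * Limit equations of a cluster *)

Section Cluster.
Context {R : realType} {T : Type} {F : set_system T} {FF : ProperFilter F}.
Variables (n : nat) (M : T -> 'I_n -> R) (x : T -> 'I_n -> 'rV[R]_2).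
Variables (Mbar : 'I_n -> R) (xbar : 'I_n -> 'rV[R]_2).
Hypothesis cc : \forall t \near F, normalized_cc (M t) (x t).
Hypothesis M_cvg : forall i, M t i @[t --> F] --> Mbar i.
Hypothesis x_cvg : forall i, x t i @[t --> F] --> xbar i.

Let cluster (a : 'I_n) : pred 'I_n := fun i => xbar i == xbar a.

(** Bodies outside the cluster have limits other than [xbar a], so no denominator tends to 0. *)
Lemma cvg_residual (a i : 'I_n) (c : 'I_2) : cluster a i ->
  residual (cluster a) (M t) (x t) i 0 c @[t --> F] -->
  residual (cluster a) Mbar xbar a 0 c.
Proof.
move=> /eqP ia; apply: cvg_coord.
rewrite /residual -ia; apply: cvgB => //.
apply: cvg_sumr => j.
rewrite /cluster -ia eq_sym => ji.
rewrite /attraction -ia; apply: cvgZ; last exact: cvgB.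
apply: cvgM => //; apply: cvgV.
  by rewrite expf_eq0 /= enorm_eq0 subr_eq0.
apply: (@continuous_cvg _ _ _ _ _ _ (fun r : R => r ^+ 3)).
  exact: exprn_continuous.
by apply: cvg_enorm; exact: cvgB.
Qed.

(* Internal attractions cancel in the weighted sum of the residuals over a
   cluster, so these residuals cannot all be close to a nonzero vector, however
   the (possibly vanishing) positive weights behave. *)
Lemma cluster_residual_eq0 (a : 'I_n) : residual (cluster a) Mbar xbar a = 0.
Proof.
apply/rowP => c; rewrite [RHS]mxE; apply/eqP/negPn/negP => g0.
set g := residual _ _ _ _ _ _ in g0.
(* The factor [g] makes the limit [g * g] positive whatever the sign of [g]. *)
have gg i : cluster a i ->
    \forall t \near F, 0 < g * residual (cluster a) (M t) (x t) i 0 c.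
  move=> ai; apply: (@cvgr_gt _ _ _ _ _ (g * g)); last first.
    by rewrite -expr2 exprn_even_gt0.
  by apply: cvgMl_tmp; exact: cvg_residual.
have /filter_ex[t [ccM gt0]] : \forall t \near F, normalized_cc (M t) (x t) /\
    forall i, cluster a i -> 0 < g * residual (cluster a) (M t) (x t) i 0 c.
  apply: filterI => //; apply: filter_forall => i.
  have [ai|ai] := boolP (cluster a i); last exact: nearW.
  by apply: filterS (gg i ai).
have [M0 _ _] := ccM.
have := residual_moment (cluster a) (fun=> g) c ccM.
under [in RHS]eq_bigr do under eq_bigr do rewrite subrr mul0r mulr0.
rewrite [in RHS]big1 ?mulr0; last by move=> i _; rewrite big1.
apply/eqP; rewrite gt_eqF// (bigD1 a)/=; last exact: eqxx.
apply: ltr_pwDl; first by rewrite mulr_gt0// gt0// /cluster.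
by apply: sumr_ge0 => i /andP[ai _]; rewrite mulr_ge0// ltW// gt0.
Qed.

(** The full sum is the one outside the cluster, as [attraction] vanishes between equal
    positions. *)
Lemma limit_balance (a : 'I_n) : xbar a = \sum_j attraction Mbar xbar a j.
Proof.
have /subr0_eq {1}-> := cluster_residual_eq0 a.
rewrite [RHS](bigID (cluster a))/= [X in _ = X + _]big1 ?add0r// => j /eqP ja.
by rewrite /attraction ja subrr scaler0.
Qed.

(* Taking moments about the heavy body [a], the attraction energy inside its
   cluster is the sum of [M i * <x i - x a, residual i>], which is
   [o(M i / |x i - x a|)]; yet it is at least the sum of
   [M a * M i / |x i - x a|]. *)
Lemma heavy_cluster (a b : 'I_n) : 0 < Mbar a -> xbar b = xbar a -> b = a.
Proof.
move=> Ma0 ba; apply/eqP/negPn/negP => bNa.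
(* The inner product of [x i - x a] with the residual of [i]; it tends to 0 on the cluster. *)
pose G t i := \sum_c (x t i 0 c - x t a 0 c) *
  residual (cluster a) (M t) (x t) i 0 c.
have GM i : cluster a i ->
    \forall t \near F, 0 < M t a - enorm (x t i - x t a) * G t i.
  move=> ai; apply: (@cvgr_gt _ _ _ _ _ (Mbar a - 0 * 0)); last first.
    by rewrite mulr0 subr0.
  apply: cvgB => //; apply: cvgM.
    have <- : enorm (xbar i - xbar a) = 0.
      by apply/eqP; rewrite enorm_eq0 (eqP ai) subrr.
    by apply: cvg_enorm; exact: cvgB.
  have -> : 0 = \sum_c ((xbar i 0 c - xbar a 0 c) *
      residual (cluster a) Mbar xbar a 0 c).
    by rewrite big1// => c _; rewrite (eqP ai) subrr mul0r.
  apply: cvg_sumr => c _.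
  apply: cvgM; last exact: cvg_residual.
  by apply: cvgB; exact: cvg_coord.
have /filter_ex[t [ccM gt0]] : \forall t \near F, normalized_cc (M t) (x t) /\
    forall i, cluster a i -> 0 < M t a - enorm (x t i - x t a) * G t i.
  apply: filterI => //; apply: filter_forall => i.
  have [ai|ai] := boolP (cluster a i); last exact: nearW.
  by apply: filterS (GM i ai).
have [M0 xinj _] := ccM.
pose K i j := M t i * M t j / enorm (x t i - x t j).
have Ksym i j : K i j = K j i.
  by rewrite /K [M t i * _]mulrC -(opprB (x t i)) enormN.
have K0 i j : 0 <= K i j.
  by rewrite /K divr_ge0 ?enorm_ge0// mulr_ge0// ltW.
have energy : \sum_(i | cluster a i) M t i * G t i =
    2^-1 * \sum_(i | cluster a i) \sum_(j | cluster a j) K i j.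
  under eq_bigr do rewrite mulr_sumr.
  rewrite exchange_big /=.
  under eq_bigr => c _ do rewrite (residual_moment _ _ c ccM).
  rewrite -mulr_sumr exchange_big /=; congr (_ * _); apply: eq_bigr => i _.
  rewrite exchange_big /=; apply: eq_bigr => j _.
  rewrite -mulr_sumr.
  (* Summing over the coordinates gives a squared distance, which reduces the inverse cube to the
     inverse distance in [K]. *)
  have -> : \sum_c (x t i 0 c - x t a 0 c - (x t j 0 c - x t a 0 c)) *
      (x t i 0 c - x t j 0 c) = enorm (x t i - x t j) ^+ 2.
    rewrite sqr_enorm; apply: eq_bigr => c _.
    by rewrite !mxE opprB addrA subrK expr2.
  (* On the diagonal both sides are 0, the inverse of 0 being 0. *)
  rewrite /K; have [->|e0] := eqVneq (enorm (x t i - x t j)) 0.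
    by rewrite !expr0n /= invr0 !mulr0.
  by rewrite -mulrA (exprS _ 2) invfM divfK// expf_neq0.
have := sum_row_le Ksym K0 (eqxx (xbar a) : cluster a a).
rewrite -energy; apply/negP; rewrite -ltNge.
rewrite (bigD1 a)/=; last exact: eqxx.
rewrite [X in _ * X]big1 ?mulr0 ?add0r; last first.
  by move=> c _; rewrite subrr mul0r.
(* The body [b] makes the sum nonempty, hence the inequality strict. *)
apply: ltr_sum.
  by apply/hasP; exists b; rewrite ?mem_index_enum// /cluster ba eqxx.
move=> i /andP[ai iNa].
have e0 : 0 < enorm (x t i - x t a).
  by rewrite enorm_gt0 subr_eq0 (inj_eq xinj).
rewrite Ksym /K ltr_pdivlMr// -mulrA ltr_pM2l// mulrC -subr_gt0.
exact: gt0.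
Qed.

End Cluster.

(** * The differential of the restricted potential *)

Lemma is_diff_coord (R : realType) (m n : nat) (A : 'M[R]_(m, n)) i j :
  is_diff A (fun B : 'M[R]_(m, n) => B i j : R) (fun B => B i j).
Proof.
have @f : {linear 'M[R]_(m, n) -> R}.
  by exists (fun B : 'M[R]_(_, _) => B i j); do 2![eexists]; do ?[constructor];
     rewrite ?mxE// => ? *; rewrite ?mxE//; move=> ?; rewrite !mxE.
rewrite -[fun _ => _]/(f : _ -> _).
apply: DiffDef; first exact: differentiable_coord.
by apply: diff_lin; exact: coord_continuous.
Qed.

Lemma is_diff_sum (R : realType) (V W : normedModType R) (I : Type)
    (r : seq I) (P : pred I) (f df : I -> V -> W) (v : V) :
  (forall i, P i -> is_diff v (f i) (df i)) ->
  is_diff v (\sum_(i <- r | P i) f i) (\sum_(i <- r | P i) df i).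
Proof.
move=> fdf; elim/big_ind2 : _ => // [|*]; first exact: is_diff_cst.
exact: is_diffD.
Qed.

Lemma is_diff_sqr_enormB (R : realType) (a x : 'rV[R]_2) :
  is_diff x (fun p => enorm (p - a) ^+ 2)
    (fun h => 2 * \sum_c (x - a) 0 c * h 0 c).
Proof.
have -> : (fun p => enorm (p - a) ^+ 2) =
    \sum_c ((fun p : 'rV[R]_2 => p 0 c) - cst (a 0 c)) ^+ 2.
  apply/funext => p; rewrite sqr_enorm fct_sumE.
  by apply: eq_bigr => c _; rewrite !mxE exprfctE.
(* The argument 1 of [is_diffX] stands for the exponent 2. *)
have := @is_diff_sum R 'rV[R]_2 R _ (index_enum 'I_2) xpredT
  (fun c => ((fun p : 'rV[R]_2 => p 0 c) - cst (a 0 c)) ^+ 2) _ x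
  (fun c _ => is_diffX 1 (is_diffB (is_diff_coord x 0 c)
     (is_diff_cst (a 0 c) x))).
move=> /is_diff_eq; apply.
apply/funext => h; rewrite fct_sumE mulr_sumr; apply: eq_bigr => c _.
by rewrite /= !fctE subr0 !mxE expr1 /GRing.scale /= mulrA.
Qed.

(** Chain rule through the squared norm, the square root and the inverse; [x != a] keeps the last
    two away from 0. *)
Lemma is_diff_invr_enormB (R : realType) (a x : 'rV[R]_2) : x != a ->
  is_diff x (fun p => (enorm (p - a))^-1)
    (fun h => - (enorm (x - a) ^+ 3)^-1 * \sum_c (x - a) 0 c * h 0 c).
Proof.
move=> xa; have e0 : 0 < enorm (x - a) by rewrite enorm_gt0 subr_eq0.
have sqr_diff := is_diff_sqr_enormB a x.
have sqrt_diff : is_diff (enorm (x - a) ^+ 2) (@Num.sqrt R)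
    (fun h => (2 * enorm (x - a))^-1 * h).
  have [sd sv] := is_derive1_sqrt (exprn_gt0 2 e0).
  have sD : differentiable (@Num.sqrt R) (enorm (x - a) ^+ 2).
    exact/derivable1_diffP.
  apply: DiffDef => //; apply/funext => h.
  rewrite deriv1E// derive1E sv sqrtr_sqr ger0_norm ?enorm_ge0//.
  exact: mulrC.
have inv_diff : is_diff (Num.sqrt (enorm (x - a) ^+ 2)) (@GRing.inv R)
    (fun h => - enorm (x - a) ^- 2 * h).
  rewrite sqrtr_sqr ger0_norm ?enorm_ge0//.
  apply: DiffDef; first by apply: differentiable_Rinv; rewrite gt_eqF.
  by rewrite diff_Rinv ?gt_eqF.
have := is_diff_comp (is_diff_comp sqr_diff sqrt_diff) inv_diff.
have -> : (@GRing.inv R \o (Num.sqrt \o (fun p => enorm (p - a) ^+ 2))) =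
    (fun p => (enorm (p - a))^-1).
  by apply/funext => p /=; rewrite sqrtr_sqr ger0_norm ?enorm_ge0.
move=> /is_diff_eq; apply; apply/funext => h /=.
rewrite !mulrA; congr (_ * _); rewrite !mulNr; congr (- _).
by field; rewrite gt_eqF.
Qed.

Lemma is_diff_Vres (R : realType) (N : nat) (m : 'I_N -> R)
    (Q : 'I_N -> 'rV[R]_2) (x : 'rV[R]_2) : (forall i, x != Q i) ->
  is_diff x (Vres m Q) (fun h => \sum_c
    (x - \sum_i (m i / enorm (x - Q i) ^+ 3) *: (x - Q i)) 0 c * h 0 c).
Proof.
move=> xQ.
have := is_diffD (is_diffZ (2^-1) (is_diff_sqr_enormB 0 x))
  (@is_diff_sum R 'rV[R]_2 R _ (index_enum 'I_N) xpredT _ _ x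
    (fun i _ => is_diffZ (m i) (is_diff_invr_enormB (xQ i)))).
have -> : 2^-1 *: (fun p => enorm (p - 0) ^+ 2) +
    \sum_i m i *: (fun p => (enorm (p - Q i))^-1) = Vres m Q.
  apply/funext => p; rewrite /Vres !fctE fct_sumE subr0 mulrC.
  by congr (_ + _).
move=> /is_diff_eq; apply; apply/funext => h.
rewrite !fctE fct_sumE subr0 /GRing.scale /= mulKf ?pnatr_eq0//.
rewrite [RHS](eq_bigr (fun c => x 0 c * h 0 c - \sum_i
  m i / enorm (x - Q i) ^+ 3 * ((x - Q i) 0 c * h 0 c))); last first.
  move=> c _; rewrite [in LHS]mxE mulrDl; congr (_ + _).
  rewrite mxE mulNr summxE mulr_suml; congr (- _); apply: eq_bigr => i _.
  by rewrite [in LHS]mxE mulrA.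
rewrite sumrB exchange_big /= -sumrN; congr (_ + _); apply: eq_bigr => i _.
by rewrite -mulr_sumr mulNr scalerN; congr (- _); exact: mulrA.
Qed.

(** * Heavy and light bodies as a single system *)

Lemma fconcat_lshift (T : Type) (N k : nat) (u : 'I_N -> T) (v : 'I_k -> T) i :
  fconcat u v (lshift k i) = u i.
Proof.
by rewrite /fconcat -[lshift k i]/(fintype.unsplit (inl i)) unsplitK.
Qed.

Lemma fconcat_rshift (T : Type) (N k : nat) (u : 'I_N -> T) (v : 'I_k -> T) j :
  fconcat u v (rshift N j) = v j.
Proof.
by rewrite /fconcat -[rshift N j]/(fintype.unsplit (inr j)) unsplitK.
Qed.

Theorem theorem8 (R : realType) (N k : nat) (E : set R)
    (m : R -> 'I_N -> R) (mu : R -> 'I_k -> R)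
    (q : R -> 'I_N -> 'rV[R]_2) (p : R -> 'I_k -> 'rV[R]_2)
    (mbar : 'I_N -> R) (qbar : 'I_N -> 'rV[R]_2) (pbar : 'I_k -> 'rV[R]_2)
    (E_gt0 : forall e, E e -> 0 < e)
    (E_to0 : limit_point E 0)
    (m_gt0 : forall e, E e -> forall i, 0 < m e i)
    (mu_gt0 : forall e, E e -> forall j, 0 < mu e j)
    (cc : forall e, E e ->
      normalized_cc (fconcat (m e) (mu e)) (fconcat (q e) (p e)))
    (mbar_gt0 : forall i, 0 < mbar i)
    (m_cvg : forall i, m e i @[e --> within E (nbhs 0)] --> mbar i)
    (mu_cvg : forall j, mu e j @[e --> within E (nbhs 0)] --> 0)
    (q_cvg : forall i, q e i @[e --> within E (nbhs 0)] --> qbar i)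
    (p_cvg : forall j, p e j @[e --> within E (nbhs 0)] --> pbar j) :
  normalized_cc mbar qbar /\
  (forall j, relative_normalized_cc mbar qbar (pbar j)).
Proof.
pose F := within E (nbhs (0 : R)).
have FF : ProperFilter F by exact/within_nbhs_proper/subset_limit_point.
pose Mbar := fconcat mbar (fun _ : 'I_k => 0 : R); pose xbar := fconcat qbar pbar.
have ccF : \forall e \near F,
    normalized_cc (fconcat (m e) (mu e)) (fconcat (q e) (p e)).
  exact: filterS cc (withinT _ _).
have M_cvg i : fconcat (m e) (mu e) i @[e --> F] --> Mbar i.
  by rewrite /Mbar /fconcat; case: fintype.split.
have x_cvg i : fconcat (q e) (p e) i @[e --> F] --> xbar i.
  by rewrite /xbar /fconcat; case: fintype.split.
have Ml i : Mbar (lshift k i) = mbar i by exact: fconcat_lshift.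
have Mr j : Mbar (rshift N j) = 0 by exact: fconcat_rshift.
have xl i : xbar (lshift k i) = qbar i by exact: fconcat_lshift.
have xr j : xbar (rshift N j) = pbar j by exact: fconcat_rshift.
(* As [b] ranges over all [N + k] bodies, this excludes heavy-heavy and light-heavy collisions
   alike. *)
have heavy i b : xbar b = qbar i -> b = lshift k i.
  by rewrite -xl; apply: (heavy_cluster ccF M_cvg x_cvg); rewrite Ml.
have balance a : xbar a = \sum_(i < N)
    (mbar i / enorm (xbar a - qbar i) ^+ 3) *: (xbar a - qbar i).
  rewrite {1}(limit_balance ccF M_cvg x_cvg a) big_split_ord /=.
  rewrite [X in _ + X]big1 ?addr0 => [|j _]; last first.
    by rewrite /attraction Mr mul0r scale0r.
  by apply: eq_bigr => i _; rewrite /attraction Ml xl.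
split; first split => //.
- move=> i j qij; apply: (@lshift_inj N k); apply: heavy.
  by rewrite xl.
- move=> i; have := balance (lshift k i).
  by rewrite xl (bigD1 i)//= subrr scaler0 add0r.
- move=> j; have pq i : pbar j != qbar i.
    apply/eqP; rewrite -xr => /heavy/eqP.
    by rewrite eq_sym eq_lrshift.
  split => //.
  (* Balance at the light body [j] is the vanishing of the gradient of [Vres] at [pbar j]. *)
  apply: is_diff_eq (is_diff_Vres _ pq) _; apply/funext => h.
  rewrite -xr -balance big1// => c _.
  by rewrite subrr mxE mul0r.
Qed.
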